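(* Let $\mu$ be a finite positive Borel measure on the unit circle $\mathbb{T}=\{z\in\mathbb{C}:|z|=1\}$ with moments $m_k=\int_{\mathbb{T}}z^k\,d\mu(z)$, let $\mu_{\mathrm{at}}$ be the atomic part of $\mu$, and for each $N\in\mathbb{N}$ let $\tilde K_N$ be the modified Christoffel–Darboux kernel built from $(m_k)_{k=0}^N$. Then for all $\theta\in[0,1]$ $$\lim_{N\to\infty}\Big[\frac{1}{\tilde K_N(e^{i2\pi\theta},e^{i2\pi\theta})}-\frac{1}{N+1}\Big]=\mu(\{e^{i2\pi\theta}\})=\mu_{\mathrm{at}}(\{e^{i2\pi\theta}\}).$$
   Context: Modified Christoffel–Darboux kernel: given moments $(m_k)_{k=0}^N$, set $\tilde m_0=m_0+1$, $\tilde m_k=m_k$ for $k>0$, and $\tilde m_{-k}=\overline{\tilde m_k}$. (These are the moments of $\mu$ plus the normalized Lebesgue measure $d\theta$ on the circle.) Let $\tilde{\mathbf{M}}_N$ be the $(N+1)\times(N+1)$ Hermitian Toeplitz matrix with entries $(\tilde{\mathbf{M}}_N)_{j,l}=\tilde m_{j-l}$, $0\le j,l\le N$; it is positive definite, hence invertible. With $\psi_N(z)=[1,z,z^2,\ldots,z^N]^\top$ and $^H$ denoting the Hermitian transpose, $\tilde K_N(z,s)=\psi_N(s)^H\tilde{\mathbf{M}}_N^{-1}\psi_N(z)$ for $z,s\in\mathbb{C}$. The Lebesgue decomposition of $\mu$ is $\mu=\mu_{\mathrm{at}}+\mu_{\mathrm{ac}}+\mu_{\mathrm{sc}}$ with $\mu_{\mathrm{at}}$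 purely atomic, and $\mu_{\mathrm{ac}}$, $\mu_{\mathrm{sc}}$ absolutely continuous and singular continuous with respect to Lebesgue measure on $\mathbb{T}$. *)

(* Defs.v *)
From HB Require Import structures.
From mathcomp Require Import all_boot all_order all_algebra.
From mathcomp Require Import all_classical all_reals all_analysis.
From mathcomp Require Import complex.

Set Implicit Arguments.
Unset Strict Implicit.
Unset Printing Implicit Defensive.

Import Order.TTheory GRing.Theory Num.Theory.
Import numFieldNormedType.Exports.

Local Open Scope classical_set_scope.
Local Open Scope ring_scope.
Local Open Scope complex_scope.
Local Open Scope sesquilinear_scope.

(* [R[i]^o] is [R[i]] with the topology of its norm. *)
Definition unit_circle (R : realType) : set R[i]^o :=
  [set z | `|z : R[i]| = 1].

Lemma unit_circle_cis (R : realType) (t : R) :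
  (cos t +i* sin t : R[i]) \in @unit_circle R.
Proof. by rewrite inE /unit_circle /= normc_def cos2Dsin2 sqrtr1. Qed.

(* The circle point exp(it). *)
Definition cis (R : realType) (t : R) : set_type (@unit_circle R) :=
  exist _ (cos t +i* sin t : R[i]) (unit_circle_cis t).

HB.instance Definition _ (R : realType) :=
  isPointed.Build (set_type (@unit_circle R)) (cis 0).

(* The circle with its Borel sigma-algebra: [open] refers to the subspace
   topology that the library puts on [set_type]. *)
Notation torus R :=
  (g_sigma_algebraType (@open (set_type (@unit_circle R)))).

Definition torus_val (R : realType) (z : torus R) : R[i] := set_val z.

Section moments.
Context {R : realType}.
Implicit Type mu : {finite_measure set (torus R) -> \bar R}.

Definition moment mu (k : nat) : R[i] :=
  (\int[mu]_z complex.Re (torus_val z ^+ k)) +i*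
  (\int[mu]_z complex.Im (torus_val z ^+ k)).

End moments.

Section kernel.
Context {R : realType}.
Implicit Type m : nat -> R[i].

Definition modified_moment m (k : int) : R[i] :=
  match k with
  | Posz 0 => m 0 + 1
  | Posz k'.+1 => m k'.+1
  | Negz k' => (m k'.+1)^*%R (* [Negz k'] is -(k'+1) *)
  end.

Definition modified_moment_mx m (N : nat) : 'M[R[i]]_N.+1 :=
  \matrix_(j < N.+1, l < N.+1) modified_moment m (j%:Z - l%:Z).

Definition monomials (N : nat) (z : R[i]) : 'cV[R[i]]_N.+1 :=
  \col_(k < N.+1) z ^+ k.

Definition modified_CD_kernel m (N : nat) (z s : R[i]) : R[i] :=
  ((monomials N s) ^t* *m invmx (modified_moment_mx m N)
     *m monomials N z) 0 0.

End kernel.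

Section decomposition.
Context {R : realType}.
Implicit Type nu : {measure set (torus R) -> \bar R}.

(* Normalized arc length: the image of the Lebesgue measure of [0, 1] under
   theta |-> exp(i 2 pi theta). *)
Definition lebesgue_torus : set (torus R) -> \bar R :=
  pushforward (mrestr lebesgue_measure (measurable_itv `[0 : R, 1]))
    (fun theta : R => cis (2 * pi * theta) : torus R).

Definition purely_atomic nu := forall A : set (torus R), measurable A ->
  nu A = \esum_(z in A) nu [set z].

Definition singular_continuous nu :=
  (forall z : torus R, nu [set z] = 0%E) /\
  (exists A : set (torus R),
    [/\ measurable A, lebesgue_torus A = 0%E & nu (~` A) = 0%E]).

Definition lebesgue_decomposition
    (mu mu_at mu_ac mu_sc : {measure set (torus R) -> \bar R}) :=
  [/\ forall A : set (torus R), measurable A ->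
        mu A = (mu_at A + mu_ac A + mu_sc A)%E,
      purely_atomic mu_at,
      mu_ac `<< lebesgue_torus &
      singular_continuous mu_sc].

End decomposition.

(* Main.v *)
(** By the variational principle, [1/K_N(z,z)] is the minimum of
    [int |p|^2 dmu + |v|^2] over the polynomials [p = v^H psi] of degree at
    most [N] with [p(z) = 1]. Every such [p] has [int |p|^2 dmu >= mu {z}], and
    [|v|^2 >= 1/(N+1)] by Cauchy-Schwarz. Conversely, the normalized Dirichlet
    kernel at [z] attains [|v|^2 = 1/(N+1)], is bounded by 1 and converges
    pointwise to the indicator of [{z}], so its integral tends to [mu {z}] by
    dominated convergence. *)
Require Import Defs.
From HB Require Import structures.
From mathcomp Require Import all_boot all_order all_algebra.
From mathcomp Require Import all_classical all_reals all_analysis.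
From mathcomp Require Import complex ring lra.

Set Implicit Arguments.
Unset Strict Implicit.
Unset Printing Implicit Defensive.

Import Order.TTheory GRing.Theory Num.Theory.
Import numFieldNormedType.Exports.

Local Open Scope classical_set_scope.
Local Open Scope ring_scope.
Local Open Scope complex_scope.

(** * Positive definite Hermitian forms and the extremal property of the inverse *)

Section extremal_form.
Local Open Scope sesquilinear_scope.
Variables (C : numClosedFieldType) (n : nat) (A : 'M[C]_n).
Implicit Types (u v psi : 'cV[C]_n).

Definition herm_form u v : C := (u^t* *m A *m v) 0 0.

Lemma map_trmxM m p q (B : 'M[C]_(m, p)) (D : 'M[C]_(p, q)) :
  (B *m D)^t* = D^t* *m B^t*.
Proof. by rewrite trmx_mul map_mxM. Qed.

Hypothesis A_gt0 : forall v, v != 0 -> 0 < herm_form v v.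

(** A vector killed by [A] has form value 0, hence is zero. Since [kermx] is a left kernel, the
    argument runs on the transpose. *)
Lemma pos_def_unitmx : A \in unitmx.
Proof.
rewrite -unitmx_tr -row_free_unit -kermx_eq0.
apply/eqP/row_matrixP => i; rewrite row0; apply/eqP/negPn/negP => r0.
have /A_gt0 : (row i (kermx A^T))^T != 0.
  by apply: contraNneq r0 => r0; rewrite -[row _ _]trmxK r0 trmx0.
rewrite /herm_form -mulmxA.
suff -> : A *m (row i (kermx A^T))^T = 0 by rewrite mulmx0 mxE ltxx.
apply: trmx_inj; rewrite trmx_mul trmxK trmx0.
by rewrite -row_mul mulmx_ker row0.
Qed.

Hypothesis A_herm : A^t* = A.

Lemma herm_formC u v : herm_form v u = (herm_form u v)^*%R.
Proof.
(* A scalar is the entry of a 1 by 1 matrix, so conjugating it amounts to taking the conjugate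
   transpose of the product. *)
have -> : (herm_form u v)^*%R = ((u^t* *m A *m v)^t*) 0 0.
  by rewrite [RHS]mxE [in RHS]mxE.
rewrite !map_trmxM A_herm mulmxA /herm_form.
by rewrite trmxCK.
Qed.

Lemma herm_form_ge0 v : 0 <= herm_form v v.
Proof.
have [->|/A_gt0/ltW//] := eqVneq v 0.
by rewrite /herm_form mulmx0 mxE.
Qed.

(* The minimizer is a multiple of [invmx A *m psi]. *)
Lemma inv_form_min psi : psi != 0 ->
  let K := (psi^t* *m invmx A *m psi) 0 0 in
  (exists2 v, (v^t* *m psi) 0 0 = 1 & herm_form v v = K^-1) /\
  forall v, (v^t* *m psi) 0 0 = 1 -> K^-1 <= herm_form v v.
Proof.
move=> psi0 /=; set K := (X in X^-1).
(* [u] represents the constraint functional: its form against any [v] is [v^t* *m psi]. In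
   particular the form of [u] with itself is [K], so [K^-1 *: u] meets the constraint. *)
pose u := invmx A *m psi.
have Au : A *m u = psi by rewrite mulKVmx// pos_def_unitmx.
have u0 : u != 0 by apply: contraNneq psi0 => u0; rewrite -Au u0 mulmx0.
have vu v : herm_form v u = (v^t* *m psi) 0 0 by rewrite /herm_form -mulmxA Au.
have KE : K = herm_form u u.
  rewrite herm_formC vu.
  have -> : ((u^t* *m psi) 0 0)^*%R = ((u^t* *m psi)^t*) 0 0.
    by rewrite [RHS]mxE [in RHS]mxE.
  rewrite map_trmxM /K -mulmxA.
  by rewrite trmxCK.
have K_gt0 : 0 < K by rewrite KE A_gt0.
have K_real : K^*%R = K by apply/CrealP; rewrite realE ltW.
have formZ a b x y : herm_form (a *: x) (b *: y) = a^*%R * b * herm_form x y.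
  rewrite /herm_form -scalemxAr.
  have -> : (a *: x)^t* = a^*%R *: x^t* by rewrite linearZ/= map_mxZ.
  by rewrite -!scalemxAl [LHS]mxE [X in b * X]mxE mulrA [b * _]mulrC.
have formD x y : herm_form (x + y) (x + y) =
    herm_form x x + herm_form x y + herm_form y x + herm_form y y.
  have D : (x + y)^t* = x^t* + y^t* by rewrite raddfD/= map_mxD.
  by rewrite /herm_form D !mulmxDl !mulmxDr !addrA;
    do 3 (rewrite [LHS]mxE; congr (_ + _)).
split=> [|v v1].
  exists (K^-1 *: u).
    rewrite -vu -[u in herm_form _ u]scale1r formZ mulr1 fmorphV/= K_real -KE.
    by rewrite mulVf ?gt_eqF.
  by rewrite formZ fmorphV/= K_real -KE -mulrA mulVf ?gt_eqF// mulr1.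
(* Completing the square: under the constraint both cross terms equal [K^-1], and so does the last
   term, which leaves the form of [v] minus [K^-1]. *)
have := herm_form_ge0 (v - K^-1 *: u).
have -> : herm_form (v - K^-1 *: u) (v - K^-1 *: u) =
    herm_form v v - K^-1 * herm_form v u - K^-1 * herm_form u v
      + K^-1 * K^-1 * herm_form u u.
  rewrite -scaleNr formD.
  have := formZ 1 (- K^-1) v u; rewrite scale1r => ->.
  have := formZ (- K^-1) 1 u v; rewrite scale1r => ->.
  rewrite formZ conjC1 rmorphN/= fmorphV/= K_real.
  ring.
rewrite (herm_formC v u) vu v1 conjC1 -KE -[_ * K]mulrA mulVf ?gt_eqF//.
by rewrite !mulr1 subrK subr_ge0.
Qed.

End extremal_form.

(** * Borel measurability on the circle *)

Section torus_measurable.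
Context {R : realType}.

Lemma continuous_complex_Re : continuous (fun z : R[i]^o => complex.Re z : R).
Proof.
move=> z; apply/(@cvgrPdist_lt _ _ _ _ (nbhs_filter z)) => e e0; apply/nbhs_ballP.
exists e%:C; first by rewrite /= ltcR.
move=> w; rewrite /ball/= normc_def ltcR; apply: le_lt_trans.
rewrite -raddfB /=; case: (z : R[i]) (w : R[i]) => a b [c d] /=.
by rewrite -sqrtr_sqr ler_wsqrtr// lerDl sqr_ge0.
Qed.

Lemma continuous_complex_Im : continuous (fun z : R[i]^o => complex.Im z : R).
Proof.
move=> z; apply/(@cvgrPdist_lt _ _ _ _ (nbhs_filter z)) => e e0; apply/nbhs_ballP.
exists e%:C; first by rewrite /= ltcR.
move=> w; rewrite /ball/= normc_def ltcR; apply: le_lt_trans.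
case: (z : R[i]) (w : R[i]) => a b [c d] /=.
by rewrite -sqrtr_sqr ler_wsqrtr// lerDr sqr_ge0.
Qed.

(** Open intervals generate the Borel sets of the line, and their preimages are open, hence
    generators of the sigma-algebra of [torus R]. *)
Lemma continuous_torus_measurable (f : set_type (@unit_circle R) -> R) :
  continuous f -> measurable_fun setT (f : torus R -> R).
Proof.
move=> /continuousP cf;
apply: (measurability _ (measurable_realfun.RGenOpens.measurableE R)).
move=> _ [_ [x [y ->]] <-]; rewrite setTI.
by apply: sub_sigma_algebra; apply: cf; exact: interval_open.
Qed.

Lemma measurable_torus_Re :
  measurable_fun setT (fun w : torus R => complex.Re (torus_val w)).
Proof.
apply: continuous_torus_measurable => w.
apply: (@continuous_comp _ _ _ (@set_val _ _) (fun z : R[i]^o => complex.Re z)).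
  exact: initial_continuous.
exact: continuous_complex_Re.
Qed.

Lemma measurable_torus_Im :
  measurable_fun setT (fun w : torus R => complex.Im (torus_val w)).
Proof.
apply: continuous_torus_measurable => w.
apply: (@continuous_comp _ _ _ (@set_val _ _) (fun z : R[i]^o => complex.Im z)).
  exact: initial_continuous.
exact: continuous_complex_Im.
Qed.

Lemma measurable_torus_set1 (z : torus R) : measurable [set z].
Proof.
(* A point is cut out by its two coordinates, each of which is a measurable function. *)
have -> : [set z] =
    (fun w : torus R => complex.Re (torus_val w)) @^-1`
      [set complex.Re (torus_val z)] `&`
    (fun w : torus R => complex.Im (torus_val w)) @^-1`
      [set complex.Im (torus_val z)].
  apply/seteqP; split=> [w -> //|w /= [wzr wzi]].
  apply/val_inj; rewrite -[LHS]/(torus_val w) -[RHS]/(torus_val z); move: wzr wzi.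
  by move: (torus_val w) (torus_val z) => [a b] [c d] /= -> ->.
by apply: measurableI; rewrite -[X in measurable X]setTI;
  [apply: measurable_torus_Re|apply: measurable_torus_Im].
Qed.

Lemma torus_norm (w : torus R) : `|torus_val w| = 1.
Proof. exact: (set_mem (valP w)). Qed.

End torus_measurable.

(** * Integration of complex-valued functions by components *)

Section complex_integral.
Context d (T : measurableType d) (R : realType).
Variable mu : {measure set T -> \bar R}.
Implicit Types (f g : T -> R[i]) (c : R[i]).

Definition cintegral f : R[i] :=
  (\int[mu]_x complex.Re (f x)) +i* (\int[mu]_x complex.Im (f x)).

Definition cintegrable f :=
  mu.-integrable setT (EFin \o (fun x => complex.Re (f x))) /\
  mu.-integrable setT (EFin \o (fun x => complex.Im (f x))).

Lemma complex_ReD (a b : R[i]) : complex.Re (a + b) = complex.Re a + complex.Re b.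
Proof. by case: a; case: b. Qed.

Lemma complex_ImD (a b : R[i]) : complex.Im (a + b) = complex.Im a + complex.Im b.
Proof. by case: a; case: b. Qed.

Lemma complex_ReM (a b : R[i]) : complex.Re (a * b) =
  complex.Re a * complex.Re b - complex.Im a * complex.Im b.
Proof. by case: a; case: b. Qed.

Lemma complex_ImM (a b : R[i]) : complex.Im (a * b) =
  complex.Re a * complex.Im b + complex.Im a * complex.Re b.
Proof. by case: a; case: b. Qed.

Lemma cintegrable0 : cintegrable (fun=> 0).
Proof. by split; exact: integrable0. Qed.

Lemma cintegral0 : cintegral (fun=> 0) = 0.
Proof. by rewrite /cintegral /Rintegral !integral0. Qed.

Lemma cintegrableD f g : cintegrable f -> cintegrable g ->
  cintegrable (fun x => f x + g x).
Proof.
move=> [fr fi] [gr gi]; split.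
  under [EFin \o _]eq_fun do rewrite /= complex_ReD EFinD.
  exact: integrableD.
under [EFin \o _]eq_fun do rewrite /= complex_ImD EFinD.
exact: integrableD.
Qed.

Lemma cintegralD f g : cintegrable f -> cintegrable g ->
  cintegral (fun x => f x + g x) = cintegral f + cintegral g.
Proof.
move=> [fr fi] [gr gi]; rewrite /cintegral.
under eq_Rintegral do rewrite complex_ReD.
under [X in _ +i* X]eq_Rintegral do rewrite complex_ImD.
by rewrite !RintegralD.
Qed.

Lemma integrable_Zl (k : R) (h : T -> R) : mu.-integrable setT (EFin \o h) ->
  mu.-integrable setT (EFin \o (fun x => k * h x)).
Proof.
move=> hi; have := integrableZl measurableT k hi.
by apply: eq_integrable.
Qed.

Lemma cintegrableZ c f : cintegrable f -> cintegrable (fun x => c * f x).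
Proof.
move=> [fr fi]; split.
  under [EFin \o _]eq_fun do rewrite /= complex_ReM EFinB.
  by apply: integrableB => //; exact: integrable_Zl.
under [EFin \o _]eq_fun do rewrite /= complex_ImM EFinD.
by apply: integrableD => //; exact: integrable_Zl.
Qed.

Lemma cintegralZ c f : cintegrable f ->
  cintegral (fun x => c * f x) = c * cintegral f.
Proof.
move=> [fr fi]; rewrite /cintegral.
under eq_Rintegral do rewrite complex_ReM.
under [X in _ +i* X]eq_Rintegral do rewrite complex_ImM.
rewrite RintegralB ?RintegralD//; try exact: integrable_Zl.
by rewrite !RintegralZl//; case: c.
Qed.

Lemma cintegrable_sum (I : Type) (r : seq I) (F : I -> T -> R[i]) :
  (forall i, cintegrable (F i)) -> cintegrable (fun x => \sum_(i <- r) F i x).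
Proof.
move=> Fi; elim: r => [|i r IH].
  by under eq_fun do rewrite big_nil; exact: cintegrable0.
by under eq_fun do rewrite big_cons; exact: cintegrableD.
Qed.

Lemma cintegral_sum (I : Type) (r : seq I) (F : I -> T -> R[i]) :
  (forall i, cintegrable (F i)) ->
  cintegral (fun x => \sum_(i <- r) F i x) = \sum_(i <- r) cintegral (F i).
Proof.
move=> Fi; elim: r => [|i r IH].
  by under eq_fun do rewrite big_nil; rewrite cintegral0 big_nil.
under eq_fun do rewrite big_cons.
by rewrite big_cons cintegralD ?IH//; exact: cintegrable_sum.
Qed.

Lemma cintegral_conj f : cintegrable f ->
  cintegral (fun x => (f x)^*%R) = (cintegral f)^*%R.
Proof.
move=> [fr fi]; rewrite /cintegral -[RHS]/(_ -i* _); congr (_ +i* _).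
  by apply: eq_Rintegral => x _; case: (f x).
rewrite -mulN1r -RintegralZl//.
by apply: eq_Rintegral => x _; case: (f x) => a b /=; rewrite mulN1r.
Qed.

Lemma cintegral_real (h : T -> R) :
  cintegral (fun x => (h x)%:C) = (\int[mu]_x h x)%:C.
Proof.
rewrite /cintegral /=; congr (_ +i* _).
by rewrite /Rintegral integral0.
Qed.

End complex_integral.

(** * The quadratic form of the modified moment matrix *)

Section toeplitz_form.
Context {R : realType}.
Variable mu : {finite_measure set (torus R) -> \bar R}.
Local Open Scope sesquilinear_scope.
Implicit Types f g : torus R -> R[i].

Definition cmeasurable f :=
  measurable_fun setT (fun w => complex.Re (f w)) /\
  measurable_fun setT (fun w => complex.Im (f w)).

Lemma cmeasurable_cst (c : R[i]) : cmeasurable (fun=> c).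
Proof. by split; exact: measurable_cst. Qed.

Lemma cmeasurableM f g : cmeasurable f -> cmeasurable g ->
  cmeasurable (fun w => f w * g w).
Proof.
move=> [fr fi] [gr gi]; split.
  under eq_fun do rewrite complex_ReM.
  by apply: measurable_realfun.measurable_funB;
    exact: measurable_realfun.measurable_funM.
under eq_fun do rewrite complex_ImM.
by apply: measurable_realfun.measurable_funD;
  exact: measurable_realfun.measurable_funM.
Qed.

Lemma cmeasurable_conj f : cmeasurable f -> cmeasurable (fun w => (f w)^*%R).
Proof.
move=> [fr fi]; split.
  by apply: eq_measurable_fun fr => w _; case: (f w).
apply: (@eq_measurable_fun _ _ _ _ _ (fun w => - complex.Im (f w))).
  by move=> w _; case: (f w).
exact: measurableT_comp.
Qed.

Lemma cmeasurable_exp k : cmeasurable (fun w => torus_val w ^+ k).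
Proof.
elim: k => [|k IH]; first exact: cmeasurable_cst.
under eq_fun do rewrite exprS.
apply: cmeasurableM => //.
by split; [exact: measurable_torus_Re|exact: measurable_torus_Im].
Qed.

Lemma ler_norm_complex (z : R[i]) :
  (`|complex.Re z|%:C <= `|z|) && (`|complex.Im z|%:C <= `|z|).
Proof.
rewrite normc_def !lecR -!sqrtr_sqr.
by rewrite !ler_wsqrtr// ?lerDl ?lerDr sqr_ge0.
Qed.

(** The measure is finite, so the constant 1 is integrable and dominates both components. *)
Lemma cintegrable_bounded f : cmeasurable f -> (forall w, `|f w| <= 1) ->
  cintegrable mu f.
Proof.
move=> [fr fi] f1; split.
  apply: (le_integrable measurableT _ _
    (finite_measure_integrable_cst mu 1 measurableT)) => //=.
    exact/measurable_realfun.measurable_EFinP.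
  move=> w _; rewrite lee_fin normr1 -lecR.
  by have /andP[/le_trans + _] := ler_norm_complex (f w); apply.
apply: (le_integrable measurableT _ _
  (finite_measure_integrable_cst mu 1 measurableT)) => //=.
  exact/measurable_realfun.measurable_EFinP.
move=> w _; rewrite lee_fin normr1 -lecR.
by have /andP[_ /le_trans] := ler_norm_complex (f w); apply.
Qed.

Lemma torus_conj_expK (w : torus R) k :
  torus_val w ^+ k * (torus_val w ^+ k)^*%R = 1.
Proof. by rewrite -normCK normrX torus_norm !expr1n. Qed.

Lemma cintegrable_monomials j l :
  cintegrable mu (fun w => torus_val w ^+ j * (torus_val w ^+ l)^*%R).
Proof.
apply: cintegrable_bounded.
  by apply: cmeasurableM; [|apply: cmeasurable_conj]; exact: cmeasurable_exp.
by move=> w; rewrite normrM norm_conjC !normrX torus_norm !expr1n mulr1.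
Qed.

(** On the circle the conjugate of [w] is its inverse, so [w ^+ j] times the conjugate of [w ^+ l]
    is the power of exponent j - l. The Kronecker delta is the Toeplitz matrix of normalized arc
    length. *)
Lemma modified_moment_mxE N (j l : 'I_N.+1) :
  modified_moment_mx (moment mu) N j l =
  cintegral mu (fun w => torus_val w ^+ j * (torus_val w ^+ l)^*%R)
    + (j == l)%:R.
Proof.
rewrite mxE -val_eqE /=.
(* Inserting the factor [w ^+ i] times its conjugate, which is 1, shifts both exponents by [i]. *)
have momE k i : moment mu k =
    cintegral mu (fun w => torus_val w ^+ (k + i) * (torus_val w ^+ i)^*%R).
  rewrite /moment -/(cintegral mu (fun w => torus_val w ^+ k)).
  congr cintegral; apply/funext => w.
  by rewrite exprD -mulrA torus_conj_expK mulr1.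
have [jl|lj|jl] := ltngtP j l.
- rewrite -(subnK jl) addnS -addSn.
  (* [Negz k] encodes -(k+1), so [k] is one less than the gap between the indices. *)
  set k := (l - j.+1)%N.
  have -> : (j%:Z - (k.+1 + j)%N%:Z)%R = Negz k.
    by rewrite PoszD opprD addrCA subrr addr0 NegzE.
  rewrite /= addr0 (momE k.+1 j) -cintegral_conj;
    last exact: cintegrable_monomials.
  by congr cintegral; apply/funext => w; rewrite rmorphM/= conjCK mulrC.
- rewrite -(subnK lj) addnS -addSn.
  set k := (j - l.+1)%N.
  have -> : ((k.+1 + l)%N%:Z - l%:Z)%R = Posz k.+1 by rewrite PoszD addrK.
  by rewrite /= addr0 (momE k.+1 l).
- by rewrite jl subrr /= (momE 0%N l).
Qed.

Lemma modified_moment_mx_herm N :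
  (modified_moment_mx (moment mu) N)^t* = modified_moment_mx (moment mu) N.
Proof.
apply/matrixP => j l; rewrite [LHS]mxE [X in (X)^*%R]mxE !modified_moment_mxE.
rewrite rmorphD/= rmorph_nat eq_sym; congr (_ + _).
rewrite -cintegral_conj; last exact: cintegrable_monomials.
by congr cintegral; apply/funext => w; rewrite rmorphM/= conjCK mulrC.
Qed.

(** The coefficients enter conjugated, so that [trig_poly v z = 1] is literally the constraint of
    [inv_form_min] for [monomials]. *)
Definition trig_poly N (v : 'cV[R[i]]_N.+1) (w : torus R) : R[i] :=
  (v^t* *m monomials N (torus_val w)) 0 0.

(** The squared modulus with values in [R] rather than [R[i]], so that it can be integrated as a
    real function. *)
Definition sqnorm (z : R[i]) : R := complex.Re z ^+ 2 + complex.Im z ^+ 2.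

Lemma sqnormE (z : R[i]) : (sqnorm z)%:C = z * z^*%R.
Proof. by rewrite add_Re2_Im2 normCK. Qed.

Lemma trig_polyE N (v : 'cV[R[i]]_N.+1) w :
  trig_poly v w = \sum_k (v k 0)^*%R * torus_val w ^+ k.
Proof. by rewrite /trig_poly mxE; apply: eq_bigr => k _; rewrite !mxE. Qed.

Lemma sqnorm_trig_polyE N (v : 'cV[R[i]]_N.+1) w :
  (sqnorm (trig_poly v w))%:C = \sum_j \sum_l
    (v j 0)^*%R * v l 0 * (torus_val w ^+ j * (torus_val w ^+ l)^*%R).
Proof.
rewrite sqnormE trig_polyE rmorph_sum mulr_suml; apply: eq_bigr => j _.
rewrite mulr_sumr; apply: eq_bigr => l _.
by rewrite rmorphM/= conjCK; ring.
Qed.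

Lemma cintegrable_sqnorm_trig_poly N (v : 'cV[R[i]]_N.+1) :
  cintegrable mu (fun w => (sqnorm (trig_poly v w))%:C).
Proof.
under eq_fun do rewrite sqnorm_trig_polyE.
apply: cintegrable_sum => j; apply: cintegrable_sum => l.
by apply: cintegrableZ; exact: cintegrable_monomials.
Qed.

(** Expanding the squared modulus of the polynomial gives the moment part of the matrix entry by
    entry; the identity part gives the Euclidean norm. *)
Lemma toeplitz_formE N (v : 'cV[R[i]]_N.+1) :
  herm_form (modified_moment_mx (moment mu) N) v v =
  (\int[mu]_w sqnorm (trig_poly v w))%:C + \sum_k `|v k 0| ^+ 2.
Proof.
rewrite -cintegral_real; under eq_fun do rewrite sqnorm_trig_polyE.
rewrite cintegral_sum; last first.
  move=> j; apply: cintegrable_sum => l.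
  by apply: cintegrableZ; exact: cintegrable_monomials.
rewrite -big_split /= /herm_form -mulmxA mxE; apply: eq_bigr => j _.
rewrite cintegral_sum; last first.
  by move=> l; apply: cintegrableZ; exact: cintegrable_monomials.
(* The Euclidean term is spread over the row with a Kronecker delta, to be merged with the integral
   term by term. *)
have -> : `|v j 0| ^+ 2 = \sum_l (v j 0)^*%R * v l 0 * (j == l)%:R.
  rewrite (bigD1 j)//= eqxx mulr1 big1 ?addr0 ?normCK 1?mulrC// => l lj.
  by rewrite eq_sym (negbTE lj) mulr0.
rewrite -big_split /= !mxE mulr_sumr; apply: eq_bigr => l _.
rewrite modified_moment_mxE cintegralZ; last exact: cintegrable_monomials.
ring.
Qed.

(** Strictness comes from the Euclidean term alone; the integral is only nonnegative, as [mu] may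
    vanish or have finite support. *)
Lemma toeplitz_form_gt0 N (v : 'cV[R[i]]_N.+1) : v != 0 ->
  0 < herm_form (modified_moment_mx (moment mu) N) v v.
Proof.
move=> v0; rewrite toeplitz_formE ltr_wpDl//.
  rewrite ler0c; apply: Rintegral_ge0 => w _.
  by rewrite addr_ge0 ?sqr_ge0.
rewrite lt_neqAle sumr_ge0 ?andbT; last by move=> k _; rewrite exprn_ge0.
apply: contra v0; rewrite eq_sym psumr_eq0 => [/allP v0|k _];
  last by rewrite exprn_ge0.
apply/eqP/matrixP => k i; rewrite ord1 mxE.
have := v0 k (mem_index_enum k); rewrite expf_eq0/= normr_eq0.
by move/eqP.
Qed.

(** Cauchy-Schwarz in explicit form: with [a] = 1/(N+1), the squared distance from [v] to [a] times
    the monomials at [z] expands to the sum minus [a], because each cross sum is the value 1 of the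
    polynomial at [z] or its conjugate. *)
Lemma sqnorm_sum_ge N (v : 'cV[R[i]]_N.+1) (z : torus R) :
  trig_poly v z = 1 -> N.+1%:R^-1 <= \sum_k `|v k 0| ^+ 2.
Proof.
move=> vz; set a : R[i] := N.+1%:R^-1.
have a_conj : a^*%R = a by rewrite fmorphV/= rmorph_nat.
have : 0 <= \sum_k `|v k 0 - a * torus_val z ^+ k| ^+ 2.
  by apply: sumr_ge0 => k _; rewrite exprn_ge0.
have -> : \sum_k `|v k 0 - a * torus_val z ^+ k| ^+ 2 =
   \sum_k (`|v k 0| ^+ 2 + a ^+ 2
     - a * ((v k 0)^*%R * torus_val z ^+ k)
     - a * ((v k 0)^*%R * torus_val z ^+ k)^*%R).
  apply: eq_bigr => k _; rewrite !normCK rmorphB rmorphM/= a_conj.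
  rewrite rmorphM/= conjCK.
  rewrite mulrBl !mulrBr.
  have -> : a * torus_val z ^+ k * (a * (torus_val z ^+ k)^*%R) = a ^+ 2.
    by rewrite mulrACA torus_conj_expK mulr1 expr2.
  ring.
rewrite !sumrB big_split/= sumr_const card_ord -!mulr_sumr -rmorph_sum.
rewrite -trig_polyE vz rmorph1 mulr1 -[a ^+ 2 *+ _]mulr_natr expr2 -mulrA.
by rewrite mulVf ?pnatr_eq0// mulr1 addrK subr_ge0.
Qed.

End toeplitz_form.

(** * Comparison of the polynomial integrals with the point mass *)

Section point_mass.
Context {R : realType}.
Variable mu : {finite_measure set (torus R) -> \bar R}.
Local Open Scope sesquilinear_scope.
Implicit Types z w : torus R.

Lemma Rintegral_indic_set1 z : \int[mu]_w \1_[set z] w = fine (mu [set z]).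
Proof.
by rewrite /Rintegral integral_indic ?setIT//; exact: measurable_torus_set1.
Qed.

Lemma sqnorm1 : sqnorm (1 : R[i]) = 1.
Proof. by rewrite /sqnorm /= expr1n expr0n addr0. Qed.

(** The squared modulus of the polynomial dominates the indicator of the point: it is 1 there and
    nonnegative elsewhere. *)
Lemma point_mass_le N (v : 'cV[R[i]]_N.+1) z : trig_poly v z = 1 ->
  fine (mu [set z]) <= \int[mu]_w sqnorm (trig_poly v w).
Proof.
move=> vz; rewrite -Rintegral_indic_set1; apply: le_Rintegral => //.
- by apply: integrable_indic; exact: measurable_torus_set1.
- by have [] := cintegrable_sqnorm_trig_poly mu v.
move=> w _; rewrite indicE; case: (boolP (w \in _)) => [/set_mem /= ->|_] /=.
  by rewrite vz sqnorm1.
by rewrite addr_ge0 ?sqr_ge0.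
Qed.

(** This is the equality case of [sqnorm_sum_ge]; its polynomial is the normalized Dirichlet kernel
    centred at [z]. *)
Definition dirichlet_vec N z : 'cV[R[i]]_N.+1 :=
  N.+1%:R^-1 *: monomials N (torus_val z).

Lemma trig_poly_dirichlet N z w : trig_poly (dirichlet_vec N z) w =
  N.+1%:R^-1 * \sum_(k < N.+1) ((torus_val z)^*%R * torus_val w) ^+ k.
Proof.
rewrite trig_polyE mulr_sumr; apply: eq_bigr => k _.
by rewrite !mxE rmorphM/= fmorphV/= rmorph_nat rmorphXn exprMn mulrA.
Qed.

Lemma torus_conjK z : (torus_val z)^*%R * torus_val z = 1.
Proof. by rewrite mulrC -normCK torus_norm expr1n. Qed.

Lemma trig_poly_dirichlet1 N z : trig_poly (dirichlet_vec N z) z = 1.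
Proof.
rewrite trig_poly_dirichlet torus_conjK.
under eq_bigr do rewrite expr1n.
by rewrite sumr_const card_ord mulVf// pnatr_eq0.
Qed.

Lemma sqnorm_sum_dirichlet N z :
  \sum_k `|dirichlet_vec N z k 0| ^+ 2 = N.+1%:R^-1.
Proof.
under eq_bigr => k _.
  rewrite !mxE normrM normrX torus_norm expr1n mulr1 normfV normr_nat; over.
rewrite sumr_const card_ord -[_ *+ _]mulr_natr expr2 -mulrA.
by rewrite mulVf ?mulr1// pnatr_eq0.
Qed.

Lemma sqnorm_ge0 (a : R[i]) : 0 <= sqnorm a.
Proof. by rewrite addr_ge0 ?sqr_ge0. Qed.

Lemma sqnorm_norm (a : R[i]) : (sqnorm a)%:C = `|a| ^+ 2.
Proof. by rewrite sqnormE normCK. Qed.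

Lemma sqnorm_dirichlet_le1 N z w : sqnorm (trig_poly (dirichlet_vec N z) w) <= 1.
Proof.
rewrite -lecR sqnorm_norm expr_le1// trig_poly_dirichlet normrM normfV normr_nat.
rewrite mulrC ler_pdivrMr ?ltr0n// mul1r (le_trans (ler_norm_sum _ _ _))//.
under eq_bigr do rewrite normrX normrM norm_conjC !torus_norm mulr1 expr1n.
by rewrite sumr_const card_ord.
Qed.

(** Away from [z] the geometric sum has a ratio [q] of modulus 1 other than 1, so it stays bounded
    while the prefactor 1/(N+1) tends to 0. *)
Lemma sqnorm_dirichlet_cvg0 z w : w <> z ->
  sqnorm (trig_poly (dirichlet_vec N z) w) @[N --> \oo] --> (0 : R).
Proof.
move=> wz; set q := (torus_val z)^*%R * torus_val w.
have q1 : q - 1 != 0.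
  rewrite subr_eq0; apply: contra_notN wz => /eqP q1; apply/val_inj.
  rewrite -[LHS]/(torus_val w) -[RHS]/(torus_val z).
  by rewrite -[LHS]mul1r -(torus_conjK z) mulrAC -/q q1 mul1r.
have qn : `|q| = 1 by rewrite normrM norm_conjC !torus_norm mulr1.
(* [D] is the square of 2/|q - 1|, which bounds every geometric sum since the numerator
   [q ^+ N.+1 - 1] has modulus at most 2. *)
pose D : R := 4 / sqnorm (q - 1).
have DE : D%:C = (2 / `|q - 1|) ^+ 2.
  rewrite exprMn exprVn -sqnorm_norm rmorphM/= fmorphV/=; congr (_ * _).
  by rewrite -natrX rmorph_nat.
apply: (@squeeze_cvgr _ _ _ _ (fun=> 0) (fun N => N.+1%:R^-1 * D)).
- apply: nearW => N; rewrite sqnorm_ge0 /= -lecR sqnorm_norm rmorphM/= DE.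
  rewrite fmorphV/= rmorph_nat trig_poly_dirichlet -/q.
  have -> : \sum_(k < N.+1) q ^+ k = (q ^+ N.+1 - 1) / (q - 1).
    by rewrite subrX1 mulrC mulrA mulVf// mul1r.
  rewrite normrM exprMn normfV normr_nat normf_div.
  apply: ler_pM; rewrite ?exprn_ge0 ?divr_ge0 ?invr_ge0 ?ler0n//.
    (* The factor 1/(N+1) squared is weakened to 1/(N+1), so that the harmonic sequence serves as
       upper bound. *)
    rewrite expr2 -[leRHS]mulr1 ler_wpM2l ?invr_ge0 ?ler0n//.
    by rewrite invf_le1 ?ltr0n// ler1n.
  rewrite lerXn2r ?nnegrE ?divr_ge0// ler_wpM2r ?invr_ge0//.
  by rewrite (le_trans (ler_normB _ _))// normrX qn expr1n normr1.
- exact: cvg_cst.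
- rewrite -[X in _ --> X](mul0r D); apply: cvgMl; exact: cvg_harmonic.
Qed.

Lemma Rintegral_dirichlet_cvg z :
  \int[mu]_w sqnorm (trig_poly (dirichlet_vec N z) w) @[N --> \oo]
    --> fine (mu [set z]).
Proof.
rewrite -Rintegral_indic_set1 /Rintegral; apply: fine_cvg.
(* Dominated convergence takes place in the extended reals; [fine] preserves the limit because that
   limit is finite. *)
rewrite fineK; last first.
  apply: integral_fune_fin_num => //.
  by apply: integrable_indic; exact: measurable_torus_set1.
apply: (dominated_cvg measurableT (g := cst 1%:E)) => //=.
- move=> N; have [/measurable_int + _] :=
    cintegrable_sqnorm_trig_poly mu (dirichlet_vec N z).
  exact.
- move=> w _; apply: cvg_EFin; first exact: nearW.
  rewrite indicE; case: (boolP (w \in _)) => [/set_mem /= ->|/negP wz] /=.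
    apply: cvg_near_cst; apply: nearW => N /=.
    by rewrite trig_poly_dirichlet1 sqnorm1.
  apply: sqnorm_dirichlet_cvg0 => wz'; apply: wz; exact/mem_set.
- exact: (finite_measure_integrable_cst mu 1 measurableT).
- move=> N w _; rewrite lee_fin ger0_norm ?sqnorm_ge0//.
  exact: sqnorm_dirichlet_le1.
Qed.

End point_mass.

(** * Points are null for arc length, and the atomic part carries the point masses *)

Section lebesgue_null.
Context {R : realType}.
Implicit Types z : torus R.

(** The angles in [0, 1] that map to [z] form a finite set. The real part suffices to see this: the
    cosine takes each value at most once on each half turn. *)
Lemma lebesgue_torus_set1_null z : (@lebesgue_torus R).-null_set [set z].
Proof.
move=> A mA Az; rewrite /lebesgue_torus /pushforward /mrestr.
apply/countable_lebesgue_measure0/finite_set_countable.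
(* [h] moves an angle into [0, pi], where the cosine is injective; for injective [h] the set has at
   most one element. *)
pose S (h : R -> R) := [set t : R |
  0 <= h t <= pi /\ cos (h t) = complex.Re (torus_val z)].
have Sc (h : R -> R) : injective h -> finite_set (S h).
  move=> hI.
  have [->|/set0P[t0 St0]] := eqVneq (S h) set0; first exact: finite_set0.
  apply: (@sub_finite_set _ _ [set t0]); last exact: finite_set1.
  move=> t [ht ct] /=; apply: hI; apply: cos_inj; rewrite ?in_itv//=.
    by case: St0.
  by rewrite ct; case: St0.
have twopi : 2 * pi != 0 :> R by rewrite mulf_neq0 ?pnatr_eq0 ?gt_eqF ?pi_gt0.
apply: (@sub_finite_set _ _
  (S (fun t => 2 * pi * t) `|` S (fun t => 2 * pi - 2 * pi * t))).
  move=> t [/= At]; rewrite in_itv/= => /andP[t0 t1].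
  have tz : cos (2 * pi * t) = complex.Re (torus_val z) by rewrite -(Az _ At).
  (* The first half turn is used as it is; the second is reflected by x -> 2 pi - x, which preserves
     the cosine. *)
  have [t2|t2] := leP t (1 / 2); [left|right]; split.
  - have := pi_gt0 R; nra.
  - by [].
  - have := pi_gt0 R; nra.
  - rewrite -tz -[RHS]cosN -(cosD2pi (- _)).
    by congr cos; rewrite addrC mulr_natl.
rewrite finite_setU; split.
- by apply: Sc => s t /(mulfI twopi).
- by apply: Sc => s t /addrI/oppr_inj/(mulfI twopi).
Qed.

(** The absolutely continuous part ignores the point because it is null for arc length, and the
    singular continuous part has no atoms. *)
Lemma lebesgue_decomposition_set1
    (mu mu_at mu_ac mu_sc : {measure set (torus R) -> \bar R}) z :
  lebesgue_decomposition mu mu_at mu_ac mu_sc -> mu [set z] = mu_at [set z].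
Proof.
case=> mu_sum _ mu_ac0 [mu_sc0 _]; have mz := measurable_torus_set1 z.
rewrite mu_sum// mu_sc0 adde0.
by rewrite (mu_ac0 _ (@lebesgue_torus_set1_null z) _ mz) ?adde0.
Qed.

End lebesgue_null.

(** * Two-sided bounds on the inverse kernel, and the limit *)

Lemma inv_CD_kernel_bounds (R : realType)
    (mu : {finite_measure set (torus R) -> \bar R}) N (z : torus R) :
  (fine (mu [set z]))%:C <=
    (modified_CD_kernel (moment mu) N (torus_val z) (torus_val z))^-1
      - N.+1%:R^-1
    <= (\int[mu]_w sqnorm (trig_poly (dirichlet_vec N z) w))%:C.
Proof.
have psi0 : monomials N (torus_val z) != 0.
  apply/eqP => /matrixP/(_ 0 0)/eqP.
  by rewrite !mxE expr0 oner_eq0.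
have [[v vz vK] Kmin] := inv_form_min (@toeplitz_form_gt0 _ mu N)
  (modified_moment_mx_herm mu N) psi0.
apply/andP; split.
  (* The lower bound is read off at the minimizer [v], the two terms of its form being bounded
     separately. *)
  rewrite /modified_CD_kernel -vK toeplitz_formE lerBrDr lerD//.
    by rewrite lecR; exact: point_mass_le.
  exact: (@sqnorm_sum_ge _ _ _ z).
(* For the upper bound the Dirichlet vector is a competitor, and its Euclidean term is exactly the
   1/(N+1) subtracted. *)
rewrite lerBlDr -(sqnorm_sum_dirichlet N z) -toeplitz_formE.
by apply: Kmin; exact: trig_poly_dirichlet1.
Qed.

Theorem theorem1 (R : realType) (mu : {finite_measure set (torus R) -> \bar R})
    (theta : R) (htheta : 0 <= theta <= 1) :
  let z : torus R := cis (2 * pi * theta) in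
  ((fun N : nat =>
      (modified_CD_kernel (moment mu) N (torus_val z) (torus_val z))^-1
      - N.+1%:R^-1 : R[i]^o) @ \oo --> ((fine (mu [set z]))%:C : R[i]^o)) /\
  (forall mu_at mu_ac mu_sc : {measure set (torus R) -> \bar R},
     lebesgue_decomposition mu mu_at mu_ac mu_sc ->
     mu [set z] = mu_at [set z]).
Proof.
move=> z; split; last first.
  by move=> mu_at mu_ac mu_sc; exact: lebesgue_decomposition_set1.
apply/cvgrPdist_lt => e e0.
(* In the order of [R[i]] a positive number is real, so the tolerance [e] can be handed to the real
   limit. *)
have /andP[/eqP Im0 Re0] : (complex.Im e == 0) && (0 < complex.Re e).
  by move: e0; rewrite ltcE.
have eE : e = (complex.Re e)%:C by rewrite [LHS]complexE Im0 mulr0 addr0.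
have /cvgrPdist_lt/(_ _ Re0) := @Rintegral_dirichlet_cvg _ mu z.
apply: filterS => N /= dN.
have /andP[lo up] := inv_CD_kernel_bounds mu N z.
rewrite distrC ger0_norm ?subr_ge0// eE.
(* The sequence lies between its limit and the Dirichlet integral, so it is at least as close to the
   limit as that integral. *)
apply: le_lt_trans (_ : (`|_|)%:C < _); last by rewrite ltcR; exact: dN.
rewrite distrC ger0_norm; last first.
  by rewrite subr_ge0 -lecR (le_trans lo up).
by rewrite rmorphB/= lerB.
Qed.
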